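(* Let $A_1(\gamma),\dots,A_d(\gamma)$ be (not necessarily independent) events indexed by $\gamma\in\mathbb{R}$, each of positive probability, with $A(\gamma)=\bigcup_{i=1}^d A_i(\gamma)$ and $\alpha(\gamma)=\mathbb{P}(A(\gamma))\to0$ as $\gamma\to\infty$. Consider the estimator of $\alpha(\gamma)$ $$\widehat{(\beta_1\ddagger\alpha)}(\gamma)=\mathbb{P}(A_1(\gamma))+\sum_{i=2}^d\mathbb{P}(A_i(\gamma))\,J_i(\gamma),$$ where $J_2(\gamma),\dots,J_d(\gamma)$ are independent random variables and $J_i(\gamma)$ has the distribution of the indicator $\mathbf{1}\{A_1(\gamma)^c\cap\dots\cap A_{i-1}(\gamma)^c\}$ under the conditional probability measure $\mathbb{P}(\,\cdot\mid A_i(\gamma))$. Then $\widehat{(\beta_1\ddagger\alpha)}$ has bounded relative error, that is, $$\limsup_{\gamma\to\infty}\frac{\operatorname{Var}\big(\widehat{(\beta_1\ddagger\alpha)}(\gamma)\big)}{\alpha(\gamma)^2}<\infty.$$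
   Context: Here $\mathbf{1}\{\cdot\}$ denotes the indicator function, and $d$ does not depend on $\gamma$. An estimator $\hat p_\gamma$ of a rare probability $p_\gamma$ has bounded relative error if $\limsup_{\gamma\to\infty}\operatorname{Var}(\hat p_\gamma)/p_\gamma^{2}<\infty$. *)

(* Defs.v *)
From HB Require Import structures.
From mathcomp Require Import all_boot all_order all_algebra finmap.
From mathcomp Require Import all_classical all_reals all_analysis.

Set Implicit Arguments.
Unset Strict Implicit.
Unset Printing Implicit Defensive.

Import Order.TTheory GRing.Theory Num.Theory.
Import numFieldNormedType.Exports.

Local Open Scope classical_set_scope.
Local Open Scope ring_scope.
Local Open Scope ereal_scope.

(* The set function B |-> P(B | E); used only when P E > 0. *)
Definition cond_prob (d : measure_display) (T : measurableType d)
    (R : realType) (P : probability T R) (E : set T) : set T -> \bar R :=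
  fun B => P (B `&` E) / P E.

(* Mutual independence of the subfamily (X i) for i in D: the product rule
   over every finite set of indices contained in D. *)
Definition mutually_independent (d : measure_display) (T : measurableType d)
    (R : realType) (P : probability T R) (I : choiceType) (D : set I)
    (X : I -> {RV P >-> R}) : Prop :=
  forall (F : {fset I}) (B : I -> set R),
    [set` F] `<=` D ->
    (forall i, i \in F -> measurable (B i)) ->
    P (\bigcap_(i in [set` F]) (X i @^-1` B i))
      = \prod_(i <- F) P (X i @^-1` B i).

(* phat g is an estimator of p g for each g, all defined on the space (T, P);
   the limsup is taken in \bar R along g --> +oo. *)
Definition bounded_relative_error (d : measure_display) (T : measurableType d)
    (R : realType) (P : probability T R) (p : R -> \bar R)
    (phat : R -> T -> R) : Prop :=
  limf_esup (fun g : R => 'V_P[phat g] / p g ^+ 2) (pinfty_nbhs R) < +oo.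

(* Events are numbered from 1 to n, as A 1, ..., A n. *)
Definition event_union (T : Type) (n : nat) (A : nat -> set T) : set T :=
  \bigcup_(i in [set i | (1 <= i <= n)%N]) A i.

Definition none_before (T : Type) (A : nat -> set T) (i : nat) : set T :=
  \bigcap_(k in [set k | (1 <= k < i)%N]) ~` A k.

(* The events live on (T, P), the variables J i, 2 <= i <= n, on (T', _). *)
Definition beta1_ddagger_alpha (d : measure_display) (T : measurableType d)
    (R : realType) (P : probability T R) (n : nat) (A : nat -> set T)
    (T' : Type) (J : nat -> T' -> R) : T' -> R :=
  fun w => (fine (P (A 1%N))
            + \sum_(2 <= i < n.+1) fine (P (A i)) * J i w)%R.

(* Main.v *)
(** The estimator is a sum of [P (A i)] with weights that almost surely lie in
    [0, 1], and each [P (A i)] is at most [alpha]. It is therefore almost surely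
    at most [d * alpha] in absolute value, which bounds its variance
    by [(2 * d * alpha) ^ 2], uniformly in [g]. *)
Require Import Defs.
From HB Require Import structures.
From mathcomp Require Import all_boot all_order all_algebra finmap.
From mathcomp Require Import all_classical all_reals all_analysis.
From mathcomp Require Import measurable_realfun.

Import Order.TTheory GRing.Theory Num.Theory.
Import numFieldNormedType.Exports.

Local Open Scope classical_set_scope.
Local Open Scope ring_scope.
Local Open Scope ereal_scope.

(** The limsup is an infimum, over the members of [F], of suprema of [f]; the member [setT] alone
    already gives the bound. *)
Lemma limf_esup_le_bound {T : choiceType} {X : filteredType T} {R : realType}
    (f : X -> \bar R) (F : set_system X) (M : \bar R) :
  F setT -> (forall x, f x <= M) -> limf_esup f F <= M.
Proof.
move=> FT fM; apply: (@le_trans _ _ (ereal_sup [set f x | x in setT])).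
  by apply: ereal_inf_lbound; exists setT.
by apply: ge_ereal_sup => _ [x _ <-].
Qed.

Lemma abs_expectation_le_bound {d : measure_display} {T : measurableType d}
    {R : realType} (P : probability T R) (X : T -> R) (M : R) :
  measurable_fun setT X -> (0 <= M)%R ->
  (\forall x \ae P, (`|X x| <= M)%R) -> `|'E_P[X]| <= M%:E.
Proof.
move=> mX M0 XM; rewrite unlock.
have /measurable_EFinP mEX := mX.
apply: (le_trans (le_abse_integral _ measurableT mEX)).
apply: (@le_trans _ _ (\int[P]_x (cst M%:E) x)).
  apply: ae_ge0_le_integral => //=.
  - by apply/measurable_EFinP; exact: measurableT_comp.
  - by apply: filterS XM => x /= XMx _; rewrite lee_fin.
by rewrite integral_cst// [X in _ * X](@probability_setT _ _ _ P) mule1.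
Qed.

(** The mean inherits the bound [M], so the deviation from it is at most [M + M]. The constant is
    crude, but only its finiteness matters later. *)
Lemma variance_le_bound {d : measure_display} {T : measurableType d}
    {R : realType} (P : probability T R) (X : T -> R) (M : R) :
  measurable_fun setT X -> (0 <= M)%R ->
  (\forall x \ae P, (`|X x| <= M)%R) -> 'V_P[X] <= ((M + M) ^+ 2)%:E.
Proof.
move=> mX M0 XM.
have EM : (`|fine 'E_P[X]| <= M)%R.
  have EXM := abs_expectation_le_bound P X M mX M0 XM.
  have Efin : 'E_P[X] \is a fin_num by rewrite fin_num_abs (le_lt_trans EXM)// ltry.
  by move: EXM; rewrite -{1}(fineK Efin) lee_fin.
(* The variance is itself an expectation, so after passing to its absolute value the expectation
   bound applies a second time, now to the squared deviation. *)
rewrite /variance unlock; apply: (le_trans (lee_abs _)).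
apply: abs_expectation_le_bound.
- by apply: measurable_funM; apply: measurable_funB.
- by rewrite sqr_ge0.
- apply: filterS XM => x /= XMx.
  have H : (`|X x - fine 'E_P[X]| <= M + M)%R.
    by rewrite (le_trans (ler_normB _ _))// lerD.
  by rewrite normrM expr2 ler_pM.
Qed.

(** Only the law of [X] is known, so the range of the indicator passes to [X] up to a null set: no
    value of an indicator lies outside [0, 1], and equality of laws gives that region mass 0 under
    [X] too. *)
Lemma ae_unit_interval_of_indicator {d d' : measure_display}
    {T : measurableType d} {T' : measurableType d'} {R : realType}
    (P : probability T R) (Q : probability T' R) (E B : set T)
    (X : {RV Q >-> R}) :
  (forall C : set R, measurable C ->
     distribution Q X C = cond_prob P E (\1_B @^-1` C)) ->
  \forall w \ae Q, (0 <= X w <= 1)%R.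
Proof.
move=> XB; exists (X @^-1` (~` `[0%R, 1%R])); split.
- rewrite -[X in measurable X]setTI; apply: measurable_funP => //.
  by apply: measurableC; exact: measurable_itv.
- have -> : Q (X @^-1` (~` `[0%R, 1%R])) = distribution Q X (~` `[0%R, 1%R]).
    by [].
  rewrite XB; last by apply: measurableC; exact: measurable_itv.
  rewrite /cond_prob (_ : _ @^-1` _ = set0) ?set0I ?measure0 ?mul0e//.
  rewrite -subset0 => x /=; apply.
  by rewrite in_itv/= indicE ler0n lern1 leq_b1.
- by move=> w /=; rewrite in_itv.
Qed.

Lemma measurable_event_union {d : measure_display} {T : measurableType d}
    (n : nat) (A : nat -> set T) :
  (forall i, (1 <= i <= n)%N -> measurable (A i)) -> measurable (event_union n A).
Proof. by move=> mA; apply: bigcup_measurable. Qed.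

Lemma measurable_beta1_ddagger_alpha {d : measure_display}
    {T : measurableType d} {d' : measure_display} {T' : measurableType d'}
    {R : realType} (P : probability T R) (n : nat) (A : nat -> set T)
    (J : nat -> T' -> R) :
  (forall i, measurable_fun setT (J i)) ->
  measurable_fun setT (beta1_ddagger_alpha P n A J).
Proof.
move=> mJ; apply: measurable_funD => //; apply: measurable_sum => i.
by apply: measurable_funM.
Qed.

(** By monotonicity each of the [n] probabilities is at most that of the union, and weights in
    [0, 1] can only shrink them. *)
Lemma abs_beta1_ddagger_alpha_le {d : measure_display} {T : measurableType d}
    {R : realType} (P : probability T R) (n : nat) (A : nat -> set T)
    (T' : Type) (J : nat -> T' -> R) (w : T') :
  (1 <= n)%N -> (forall i, (1 <= i <= n)%N -> measurable (A i)) ->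
  (forall i, (2 <= i <= n)%N -> (0 <= J i w <= 1)%R) ->
  (`|beta1_ddagger_alpha P n A J w| <= n%:R * fine (P (event_union n A)))%R.
Proof.
move=> n1 mA J01; set a := fine _.
have PAa i : (1 <= i <= n)%N -> (0 <= fine (P (A i)) <= a)%R.
  move=> i1n; rewrite fine_ge0//= fine_le ?fin_num_measure//.
  - by apply: mA.
  - by apply: measurable_event_union.
  - rewrite le_measure ?inE//; first exact: mA.
      exact: measurable_event_union.
    by move=> x Ax; exists i.
have S0 : (0 <= \sum_(2 <= i < n.+1) fine (P (A i)) * J i w)%R.
  rewrite big_nat_cond sumr_ge0// => i; rewrite andbT => /andP[i2 id].
  have /andP[PA0 _] := PAa i ltac:(by rewrite (ltnW i2)).
  have /andP[J0 _] := J01 i ltac:(by rewrite i2).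
  exact: mulr_ge0.
have /andP[PA0 PA1] := PAa 1%N ltac:(by rewrite n1).
rewrite /beta1_ddagger_alpha ger0_norm ?addr_ge0//.
(* One copy of [a] is set aside for the unweighted first term; the other [n - 1] match the sum over
   2, ..., [n] term by term. *)
have -> : (n%:R * a = a + \sum_(2 <= i < n.+1) a)%R.
  by rewrite sumr_const_nat -mulrS subSS -subSn// subn1/= mulr_natl.
apply: lerD => //; rewrite big_nat_cond [leRHS]big_nat_cond.
apply: ler_sum => i; rewrite andbT => /andP[i2 id].
have /andP[PAi0 PAia] := PAa i ltac:(by rewrite (ltnW i2)).
have /andP[J0 J1] := J01 i ltac:(by rewrite i2).
by rewrite -[leRHS]mulr1 ler_pM.
Qed.

Theorem corollary1 (R : realType)
  (dT : measure_display) (T : measurableType dT) (P : probability T R)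
  (dT' : measure_display) (T' : measurableType dT') (Q : probability T' R)
  (d : nat) (A : nat -> R -> set T) (J : nat -> R -> {RV Q >-> R})
  (alpha : R -> \bar R) :
  (1 <= d)%N ->
  (forall i g, (1 <= i <= d)%N -> measurable (A i g)) ->
  (forall i g, (1 <= i <= d)%N -> 0 < P (A i g)) ->
  (forall g, alpha g = P (event_union d (A ^~ g))) ->
  alpha g @[g --> +oo%R] --> 0 ->
  (forall g, mutually_independent [set i | (2 <= i <= d)%N] (J ^~ g)) ->
  (forall i g, (2 <= i <= d)%N -> forall B : set R, measurable B ->
     distribution Q (J i g) B
       = cond_prob P (A i g) (\1_(none_before (A ^~ g) i) @^-1` B)) ->
  bounded_relative_error Q alpha
    (fun g => beta1_ddagger_alpha P d (A ^~ g) (J ^~ g)).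
Proof.
move=> d1 mA PA0 alphaE _ _ Jdistr.
(* With [M = d * a], where [a] is the real value of [alpha g], the variance bound is
   [(d * a + d * a) ^ 2]; dividing by [a ^ 2] leaves this constant, the same for every [g]. *)
apply: (@le_lt_trans _ _ ((d%:R + d%:R) ^+ 2)%:E); last by rewrite ltry.
apply: limf_esup_le_bound => [|g]; first exact: filterT.
have mU := measurable_event_union d (A ^~ g) (fun i => mA i g).
set a := fine (P (event_union d (A ^~ g))).
have aE : alpha g = a%:E by rewrite alphaE /a fineK// fin_num_measure.
(* The union contains [A 1 g], which has positive probability; this makes the division by [a ^ 2] an
   ordinary real one. *)
have a0 : (0 < a)%R.
  rewrite -lte_fin -aE alphaE; apply: (lt_le_trans (PA0 1%N g d1)).
  rewrite le_measure ?inE//; first exact: mA.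
  by move=> x Ax; exists 1%N.
have Xle : \forall w \ae Q,
    (`|beta1_ddagger_alpha P d (A ^~ g) (J ^~ g) w| <= d%:R * a)%R.
  have : \forall w \ae Q, forall i, (2 <= i <= d)%N -> (0 <= J i g w <= 1)%R.
    (* A countable union of null sets is null, so one exceptional set serves all indices; outside 2,
       ..., [d] the claim is vacuous. *)
    apply: ae_foralln => i; case: (boolP (2 <= i <= d)%N) => id; last exact: aeW.
    have := ae_unit_interval_of_indicator P Q _ _ (J i g) (Jdistr i g id).
    by apply: filterS.
  by apply: filterS => w; apply: abs_beta1_ddagger_alpha_le => // i; apply: mA.
rewrite aE -EFin_expe inver gt_eqF ?exprn_gt0// lee_pdivrMr ?exprn_gt0//.
apply: (le_trans (variance_le_bound _ _ _ _ _ Xle)).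
- by apply: measurable_beta1_ddagger_alpha => i.
- by rewrite mulr_ge0// ltW.
- by rewrite -EFinM lee_fin -mulrDl exprMn.
Qed.
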